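(* Let the following multiple, nested sums (with $m$ summations in total) be defined as $$\Sigma_m(i, j) := \sum_{k_1=j+2}^i \ \sum_{k_2=j+2}^{k_1-1} \cdots \sum_{k_m=j+2}^{k_{m-1}-1} s_{i,k_1-1} \cdot s_{k_1-1,k_2-1} \times \cdots \times s_{k_m-1,j}.$$ Then the inverse matrix entries $s_{i,j}^{(-1)}$ have the exact expansion $$s_{i,j}^{(-1)} = \delta_{i,j} - s_{i,j} + \Sigma_1(i, j) - \Sigma_2(i, j) + \cdots + (-1)^{i+j+1}\, \Sigma_{i-j}(i, j).$$
   Context: For integers $i,j\ge 1$ let $s_{i,j} := s_o(i,j)-s_e(i,j)$, where $s_o(i,j)$ (respectively $s_e(i,j)$) is the number of $j$'s appearing in all partitions of $i$ into an odd (respectively even) number of distinct parts. Equivalently, $s_{i,j} = [q^i]\, \frac{q^j}{1-q^j}\,(q;q)_\infty$, where $(q;q)_\infty=\prod_{m\ge1}(1-q^m)$ and $[q^i]$ denotes the coefficient of $q^i$. For $N\ge1$ let $A_N := (s_{i,j})_{1\le i,j\le N}$; this matrix is lower triangular with ones on its diagonal, hence invertible. Let $s_{i,j}^{(-1)}$ denote the $(i,j)$ entry of $A_N^{-1}$, for any $N\ge\max(i,j)$; it does not depend on the choice of such $N$. $\delta_{i,j}$ is the Kronecker delta (equal to $1$ if $i=j$ and $0$ otherwise). Sums whose upper limit is smaller than the lower limit are $0$.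
   Formalization: The expansion is stated only for i ≠ j: for i = j its right side is δ_{i,i} − s_{i,i} = 1 − 1 = 0, while the inverse entry is 1, so on the diagonal the entry is stated to be δ_{i,j} instead. *)

(* Defs.v *)
From HB Require Import structures.
From mathcomp Require Import all_boot all_order all_algebra.

Set Implicit Arguments.
Unset Strict Implicit.
Unset Printing Implicit Defensive.

Import Order.TTheory GRing.Theory Num.Theory.
Local Open Scope ring_scope.

(* A partition of n into distinct parts is determined by its set of parts,
   a set of positive integers, all at most n, whose sum is n. *)
Definition distinct_partition (n : nat) (P : {set 'I_n.+1}) : bool :=
  (ord0 \notin P) && (\sum_(x in P) (x : nat) == n)%N.

Definition occurrences (n : nat) (P : {set 'I_n.+1}) (j : nat) : nat :=
  #|[set x in P | (x : nat) == j]|.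

Definition s_o (i j : nat) : nat :=
  (\sum_(P : {set 'I_i.+1} | distinct_partition P && odd #|P|)
     occurrences P j)%N.

Definition s_e (i j : nat) : nat :=
  (\sum_(P : {set 'I_i.+1} | distinct_partition P && ~~ odd #|P|)
     occurrences P j)%N.

Definition s (i j : nat) : int := (s_o i j)%:Z - (s_e i j)%:Z.

(* Rows and columns are numbered from 0 in 'M_N, from 1 in the mathematics. *)
Definition A (N : nat) : 'M[int]_N := \matrix_(r, c) s r.+1 c.+1.

(* The m-fold nested sum
     \sum_(j+2 <= k_1 <= i) \sum_(j+2 <= k_2 <= k_1-1) ...
       s i (k_1-1) * s (k_1-1) (k_2-1) * ... * s (k_m-1) j
   with each factor taken out of the sums that do not involve it.  The bounds
   on k_2, ..., k_m are those on k_1 with i replaced by k_1-1, ..., k_(m-1)-1;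
   k < i.+1 says k <= i. *)
Fixpoint Sigma (m i j : nat) : int :=
  if m is m'.+1 then
    \sum_(j.+2 <= k < i.+1) s i k.-1 * Sigma m' k.-1 j
  else s i j.

Lemma s_upper (i j : nat) : (i < j)%N -> s i j = 0.
Proof.
move=> ij; have occ0 (P : {set 'I_i.+1}) : occurrences P j = 0%N.
  apply/eqP; rewrite cards_eq0; apply/eqP/setP => x; rewrite !inE.
  apply/negbTE/nandP; right; apply/eqP => xj.
  by have := ltn_ord x; rewrite xj ltnS leqNgt ij.
by rewrite /s /s_o /s_e !big1.
Qed.

Lemma s_diag (i : nat) : (0 < i)%N -> s i i = 1.
Proof.
move=> i0.
have occ (P : {set 'I_i.+1}) : distinct_partition P ->
    occurrences P i = (P == [set ord_max])%N.
  move=> /andP[P0 /eqP Pi].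
  have [->|PN] := eqVneq P [set ord_max].
    rewrite /occurrences (_ : [set x in _ | _] = [set ord_max]) ?cards1 //.
    apply/setP => x; rewrite !inE -val_eqE /=.
    by case: eqP.
  apply/eqP; rewrite cards_eq0; apply/eqP/setP => x; rewrite !inE.
  apply/negbTE/negP => /andP[xP /eqP xi]; case/eqP: PN.
  have xm : x = ord_max by apply: val_inj.
  apply/setP => y; rewrite inE; apply/idP/eqP => [yP|->]; last by rewrite -xm.
  apply/eqP; case: (eqVneq y ord_max) => // ym.
  move: Pi; rewrite (bigD1 x) //= (bigD1 y) /=; last by rewrite yP xm.
  rewrite xi => /eqP; rewrite -[X in _ == X]addn0 eqn_add2l addn_eq0.
  case/andP => /eqP y0 _.
  by move: P0; rewrite (_ : ord0 = y) ?yP //; apply: val_inj.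
rewrite /s /s_o /s_e.
rewrite (bigD1 [set ord_max]) /=; last first.
  by rewrite cards1 /distinct_partition inE big_set1 -val_eqE /= eqxx andbT neq_ltn i0.
rewrite big1 => [|P /andP[/andP[dP _] /negbTE PN]]; last by rewrite occ ?PN.
rewrite big1 => [|P /andP[dP oP]].
  rewrite occ ?eqxx //.
  by rewrite /distinct_partition inE big_set1 -val_eqE /= eqxx andbT neq_ltn i0.
rewrite occ //; case: eqP oP => // ->; by rewrite cards1.
Qed.

(* A N is invertible over int, so invmx (A N) is its inverse. *)
Lemma A_unitmx (N : nat) : A N \in unitmx.
Proof.
rewrite unitmxE det_trig.
  by rewrite big1 ?unitr1 // => r _; rewrite mxE s_diag.
by apply/is_trig_mxP => r c rc; rewrite mxE s_upper.
Qed.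

(* Main.v *)
Require Import Defs.
From mathcomp Require Import all_boot all_order all_algebra.

(** Write [A N = 1 + L] with [L] strictly lower triangular, hence nilpotent, so
    that the inverse is the finite Neumann series [\sum_p (-1)^p L^p].  After the
    substitution [l = k - 1] in each summation, [Sigma m i j] runs over the
    strictly decreasing chains [i > l_1 > ... > l_m > j]; for [j < i] it is
    therefore the entry of [L^(m+1)], which explains the sign [(-1)^(m+1)].

    The powers of [L] need not be formed.  The relation [X = -L - L X] for
    [X = \sum_(p >= 1) (-1)^p L^p] is, entry by entry, the recursion defining
    [Sigma] ([alt_SigmaS]), and the nilpotency of [L] says that no chain from
    [i] to [j] has more than [i - j - 1] intermediate points ([Sigma_eq0]), so
    that all long enough truncations of the series agree ([alt_Sigma_stable]).
    Together they show that [1 + X] is a right inverse of [A N]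
    ([sum_s_inv_entry]), and a right inverse of a square matrix is its
    inverse. *)

Import Order.TTheory GRing.Theory Num.Theory.
Local Open Scope ring_scope.

Lemma SigmaS (m i j : nat) :
  Sigma m.+1 i j = \sum_(j.+1 <= l < i) s i l * Sigma m l j.
Proof. by rewrite /= big_add1. Qed.

(** Strictly between [j] and [i] there are only [i - j - 1] integers, too few
    for a chain with [m >= i - j] intermediate points. *)
Lemma Sigma_eq0 (m i j : nat) : (j < i)%N -> (i - j <= m)%N -> Sigma m i j = 0.
Proof.
elim: m i => [|m IHm] i ji; first by rewrite leqn0 subn_eq0 leqNgt ji.
move=> im; rewrite SigmaS big_nat big1 // => l /andP[jl li].
rewrite IHm ?mulr0 // -ltnS; apply: leq_trans im.
by rewrite ltn_sub2r.
Qed.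

(** Below the diagonal, the entries of the Neumann series of [A N] without its
    identity term, truncated after [M] terms. *)
Definition alt_Sigma (M i j : nat) : int :=
  \sum_(0 <= m < M) (-1) ^+ m.+1 * Sigma m i j.

Lemma alt_SigmaS (M i j : nat) :
  alt_Sigma M.+1 i j = - s i j - \sum_(j.+1 <= l < i) s i l * alt_Sigma M l j.
Proof.
rewrite /alt_Sigma big_nat_recl //= expr1 mulN1r; congr (_ + _).
under [in RHS]eq_bigr => l _ do rewrite mulr_sumr.
rewrite exchange_big -sumrN; apply: eq_bigr => m _.
rewrite -/(Sigma m.+1 i j) SigmaS exprS mulN1r mulNr mulr_sumr.
by congr (- _); apply: eq_bigr => l _; rewrite mulrCA.
Qed.

Lemma alt_Sigma_stable (M i j : nat) :
  (j < i)%N -> (i - j <= M)%N -> alt_Sigma M i j = alt_Sigma (i - j) i j.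
Proof.
move=> ji iM; rewrite /alt_Sigma (big_cat_nat (n := (i - j)%N)) //=.
rewrite [X in _ + X]big_nat [X in _ + X]big1 ?addr0 // => m /andP[im _].
by rewrite Sigma_eq0 ?mulr0.
Qed.

(** The number of terms is a parameter [M] instead of [i - j], so that the same
    truncation serves a whole column in [sum_s_inv_entry]. *)
Definition inv_entry (M i j : nat) : int :=
  if (j < i)%N then alt_Sigma M i j else (i == j)%:R.

(** Only [j <= l <= i] contributes.  Below the diagonal, the terms [l = j] and
    [j < l < i] add up to minus the truncation with one more term, by
    [alt_SigmaS], and the term [l = i] cancels it. *)
Lemma sum_s_inv_entry (N i j : nat) : (0 < i <= N)%N -> (0 < j <= N)%N ->
  \sum_(1 <= l < N.+1) s i l * inv_entry N l j = (i == j)%:R.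
Proof.
move=> /andP[i0 iN] /andP[j0 jN].
have above l : (l < j)%N -> inv_entry N l j = 0.
  by move=> lj; rewrite /inv_entry ltnNge (ltnW lj) (ltn_eqF lj).
have diag : inv_entry N j j = 1 by rewrite /inv_entry ltnn eqxx.
have [ij|ji] := ltnP i j.
  rewrite big1 ?(ltn_eqF ij) // => l _.
  have [lj|jl] := ltnP l j; first by rewrite above ?mulr0.
  by rewrite s_upper ?mul0r // (leq_trans ij).
rewrite (big_cat_nat (n := j)) ?(leq_trans jN) //=.
rewrite big_nat big1 ?add0r => [|l /andP[_ lj]]; last by rewrite above ?mulr0.
rewrite (big_cat_nat (n := i.+1)) ?(leq_trans ji) //= addrC.
rewrite big_nat big1 ?add0r => [|l /andP[il _]]; last by rewrite s_upper ?mul0r.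
have [ij|nij] := eqVneq i j; first by rewrite ij big_nat1 diag s_diag ?mulr1.
have {}ji : (j < i)%N by rewrite ltn_neqAle eq_sym nij.
rewrite big_nat_recr 1?ltnW //= big_ltn // diag mulr1 s_diag // mul1r.
have -> : inv_entry N i j = alt_Sigma N.+1 i j.
  have iMN : (i - j <= N)%N by rewrite (leq_trans (leq_subr _ _)).
  by rewrite /inv_entry ji !alt_Sigma_stable // (leq_trans iMN).
rewrite alt_SigmaS big_nat [X in _ - X]big_nat.
under eq_bigr => l /andP[jl _] do rewrite /inv_entry jl.
by rewrite -opprD subrr.
Qed.

Lemma invmx_A (N : nat) :
  invmx (A N) = \matrix_(r, c) inv_entry N r.+1 c.+1.
Proof.
set B := \matrix_(r, c) _.
suff AB : A N *m B = 1%:M by rewrite -[LHS]mulmx1 -AB mulKmx ?A_unitmx.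
apply/matrixP => r c; rewrite !mxE.
under eq_bigr => l _ do rewrite !mxE.
have := sum_s_inv_entry N r.+1 c.+1 (ltn_ord r) (ltn_ord c).
by rewrite big_add1 big_mkord => ->; rewrite eqSS.
Qed.

(* At i = j the expansion evaluates to delta - s = 0, whereas the diagonal
   entries of the inverse are 1; they are therefore stated separately. *)
Theorem corollary2p2 (N : nat) (i j : nat) (r c : 'I_N)
    (hi : i = r.+1) (hj : j = c.+1) :
  (i <> j ->
     invmx (A N) r c =
       (i == j)%:R - s i j
       + \sum_(1 <= m < (i - j).+1) (-1) ^+ m.+1 * Sigma m i j)
  /\ (i = j -> invmx (A N) r c = (i == j)%:R).
Proof.
have iN : (i <= N)%N by rewrite hi.
rewrite invmx_A mxE -hi -hj /inv_entry.
split=> [/eqP nij|->]; last by rewrite ltnn.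
have [ji|ij] := ltnP j i; last first.
  have {}ij : (i < j)%N by rewrite ltn_neqAle nij.
  move: (ltnW ij); rewrite -subn_eq0 => /eqP ->.
  by rewrite s_upper // big_geq // subr0 addr0.
(* The stated sum has the term m = i - j, which vanishes, and its term m = 0
   is the isolated - s i j. *)
rewrite (negbTE nij) add0r alt_Sigma_stable ?(leq_trans (leq_subr _ _)) //.
rewrite -(alt_Sigma_stable (i - j).+1) // /alt_Sigma big_ltn //.
by rewrite expr1 mulN1r.
Qed.
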